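(* Every first-countable $T_0$ space is a well-filtered determined space.
   Context: For a $T_0$ space $X$, the specialization order is $x\le y$ iff $x\in\overline{\{y\}}$; a subset is saturated if it is an upper set in this order (equivalently, an intersection of open sets). $\mathsf{K}(X)$ is the set of all nonempty compact saturated subsets of $X$. A family $\mathcal K\subseteq\mathsf K(X)$ is filtered if it is nonempty and for all $K_1,K_2\in\mathcal K$ there is $K_3\in\mathcal K$ with $K_3\subseteq K_1\cap K_2$. A $T_0$ space $Y$ is well-filtered if for every open $U\subseteq Y$ and every filtered family $\mathcal K\subseteq\mathsf K(Y)$, $\bigcap\mathcal K\subseteq U$ implies $K\subseteq U$ for some $K\in\mathcal K$. A nonempty set $A\subseteq X$ is irreducible if whenever $A\subseteq F_1\cup F_2$ with $F_1,F_2$ closed, then $A\subseteq F_1$ or $A\subseteq F_2$. A subset $A$ of a $T_0$ space $X$ is well-filtered determined if for every continuous map $f:X\to Y$ to a well-filtered space $Y$ there is a unique $y_A\in Y$ with $\overline{f(A)}=\overline{\{y_A\}}$. A $T_0$ space $X$ is a well-filtered determined space if all irreducible closed subsets of $X$ are well-filtered determined. *)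

(* Defs.v *)
From mathcomp Require Import all_boot all_order all_algebra.
From mathcomp Require Import all_classical all_reals all_analysis.

Set Implicit Arguments.
Unset Strict Implicit.
Unset Printing Implicit Defensive.

Local Open Scope classical_set_scope.

Section SpecializationOrder.
Context {X : topologicalType}.
Implicit Types A K U : set X.

Definition specialization_le (x y : X) : Prop := closure [set y] x.

Definition saturated A : Prop :=
  forall x y, specialization_le x y -> A x -> A y.

Definition compact_saturated : set (set X) :=
  [set K | [/\ K !=set0, compact K & saturated K]].

Definition filtered_family (F : set (set X)) : Prop :=
  F !=set0 /\
  forall K1 K2, F K1 -> F K2 -> exists2 K3, F K3 & K3 `<=` K1 `&` K2.

Definition irreducible_set A : Prop :=
  A !=set0 /\
  forall F1 F2 : set X, closed F1 -> closed F2 ->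
    A `<=` F1 `|` F2 -> A `<=` F1 \/ A `<=` F2.

End SpecializationOrder.

Definition well_filtered_space (Y : topologicalType) : Prop :=
  kolmogorov_space Y /\
  forall (U : set Y) (F : set (set Y)),
    open U -> F `<=` compact_saturated -> filtered_family F ->
    \bigcap_(K in F) K `<=` U -> exists2 K, F K & K `<=` U.

Definition well_filtered_determined (X : topologicalType) (A : set X) : Prop :=
  forall (Y : topologicalType) (f : X -> Y),
    well_filtered_space Y -> continuous f ->
    exists! y : Y, closure (f @` A) = closure [set y].

Definition well_filtered_determined_space (X : topologicalType) : Prop :=
  kolmogorov_space X /\
  forall A : set X, closed A -> irreducible_set A -> well_filtered_determined A.

Definition first_countable (X : topologicalType) : Prop :=
  forall x : X, exists B : set (set X),
    [/\ countable B, B `<=` nbhs x &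
        forall V, nbhs x V -> exists2 W, B W & W `<=` V].

(* Main.v *)
(** Call a sequence self-convergent if it converges to each of its own terms.
    The saturations of the tails of such a sequence are compact. In a
    first-countable space, a diagonal choice inside an irreducible set A yields,
    for every sequence a in A, a self-convergent sequence in A converging to
    every [a i]. Map these sequences to a well-filtered space Y by f: the
    intersections of their saturated tails form a filtered family of compact
    saturated sets, all meeting the closure of [f @` A], so some point b of that
    closure lies in all of them. Every [f x] with [x] in A is then below b,
    i.e., b is a generic point. *)
Require Import Defs.
From mathcomp Require Import all_boot all_order all_algebra.
From mathcomp Require Import all_classical all_reals all_analysis.

Set Implicit Arguments.
Unset Strict Implicit.
Unset Printing Implicit Defensive.

Local Open Scope classical_set_scope.

(** * Specialization order and well-filteredness *)

Section Specialization.
Variable Y : topologicalType.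
Implicit Types (x y z : Y) (W K B : set Y).

Lemma specialization_le_refl x : specialization_le x x.
Proof. exact: subset_closure. Qed.

Lemma specialization_le_nbhs x y W : specialization_le x y -> nbhs x W -> W y.
Proof. by move=> xy /xy[_ [-> ]]. Qed.

Lemma specialization_le_trans y x z :
  specialization_le x y -> specialization_le y z -> specialization_le x z.
Proof.
move=> xy yz W; rewrite nbhsE => -[V [oV Vx] VW].
exists z; split=> //; apply: VW; apply: (specialization_le_nbhs yz).
apply: open_nbhs_nbhs; split=> //.
by apply: (specialization_le_nbhs xy); exact: open_nbhs_nbhs.
Qed.

Lemma closure1_inj : kolmogorov_space Y -> injective (fun y => closure [set y]).
Proof.
move=> T0 x y /= exy.
have xy : specialization_le x y by rewrite /specialization_le -exy; exact: subset_closure.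
have yx : specialization_le y x by rewrite /specialization_le exy; exact: subset_closure.
apply: contrapT => /eqP /T0 [A [[]|[]]]; rewrite !inE => Az; apply.
- exact: specialization_le_nbhs xy Az.
- exact: specialization_le_nbhs yx Az.
Qed.

(** A saturated set is the intersection of its open neighborhoods: for [z] outside [K], the
    complement of [closure [set z]] is open and contains [K]. *)
Lemma saturated_sub_open K B : saturated K ->
  (forall W, open W -> K `<=` W -> B `<=` W) -> B `<=` K.
Proof.
move=> satK BK z Bz; apply: contrapT => nKz.
have /(_ z Bz) : B `<=` ~` closure [set z].
  apply: BK; first exact/closed_openC/closed_closure.
  by move=> y Ky yz; apply: nKz; exact: (satK y).
by apply; exact: subset_closure.
Qed.

(** Contrapositive of well-filteredness for the open complement of [B]. *)
Lemma well_filtered_meets (F : set (set Y)) B : well_filtered_space Y ->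
    F `<=` compact_saturated -> filtered_family F -> closed B ->
  (forall K, F K -> K `&` B !=set0) -> (\bigcap_(K in F) K) `&` B !=set0.
Proof.
move=> [_ wf] Fcs Ff cB FB; apply: contrapT => FB0.
have [||K FK KB] := wf (~` B) F _ Fcs Ff.
- exact: closed_openC.
- by move=> z Fz Bz; apply: FB0; exists z.
- by have [z [/KB]] := FB K FK.
Qed.

End Specialization.

(** * Self-convergent sequences and their saturated tails *)

Section SelfConvergent.
Variable Y : topologicalType.
Implicit Types (d : nat -> Y) (y : Y) (W B : set Y).

Definition self_convergent d := forall n, d @ \oo --> d n.

Definition up_tail d n : set Y :=
  [set z | exists2 k, (n <= k)%N & specialization_le (d k) z].

Definition up_limit d : set Y := \bigcap_n up_tail d n.

Lemma up_tailS d m n : (m <= n)%N -> up_tail d n `<=` up_tail d m.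
Proof. by move=> mn z [k nk kz]; exists k => //; exact: leq_trans nk. Qed.

Lemma mem_up_tail d n : up_tail d n (d n).
Proof. by exists n => //; exact: specialization_le_refl. Qed.

Lemma saturated_up_tail d n : saturated (up_tail d n).
Proof.
by move=> x y xy [k nk kx]; exists k => //; exact: specialization_le_trans xy.
Qed.

Lemma saturated_up_limit d : saturated (up_limit d).
Proof. by move=> x y xy dx n _; apply: saturated_up_tail xy _; exact: dx. Qed.

Lemma cvg_up_tail d y W : d @ \oo --> y -> nbhs y W ->
  exists n, up_tail d n `<=` W.
Proof.
move=> dy; rewrite nbhsE => -[V [oV Vy] VW].
have [n _ nV] : (d @ \oo) V by apply: dy; exact: open_nbhs_nbhs.
exists n => z [k nk kz]; apply: VW; apply: (specialization_le_nbhs kz).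
by apply: open_nbhs_nbhs; split=> //; exact: nV.
Qed.

(* If a filter containing the tail clusters at no term, then it contains all
   later tails by induction; but these enter any neighborhood of [d n]. *)
Lemma compact_up_tail d n : self_convergent d -> compact (up_tail d n).
Proof.
move=> sd F PF Fd; apply: contrapT => noclus.
have sep k : (n <= k)%N ->
    exists A W, [/\ F A, nbhs (d k) W & A `&` W = set0].
  move=> nk; apply: contrapT => nsep; apply: noclus; exists (d k).
  split; first exact: up_tailS nk _ (mem_up_tail d k).
  move=> A W FA dW; apply: contrapT => /set0P/negP/negPn/eqP AW0.
  by apply: nsep; exists A, W.
have Ftail j : F (up_tail d (n + j)).
  elim: j => [|j IH]; first by rewrite addn0.
  have [A [W [FA dW AW0]]] := sep _ (leq_addr j n).
  apply: filterS (filterI IH FA) => z [[k]].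
  rewrite addnS leq_eqVlt => /predU1P[<- kz Az|nk kz _]; last by exists k.
  suff : (A `&` W) z by rewrite AW0.
  by split=> //; exact: specialization_le_nbhs kz dW.
have [A [W [FA dW AW0]]] := sep _ (leqnn n).
have [m mW] := cvg_up_tail (sd n) dW.
have [z [nmz Az]] := filter_ex (filterI (Ftail m) FA).
suff : (A `&` W) z by rewrite AW0.
by split=> //; apply: mW; exact: up_tailS (leq_addl _ _) _ nmz.
Qed.

Lemma compact_saturated_up_tail d n : self_convergent d ->
  compact_saturated (up_tail d n).
Proof.
move=> sd; split.
- by exists (d n); exact: mem_up_tail.
- exact: compact_up_tail.
- exact: saturated_up_tail.
Qed.

Lemma filtered_up_tail d : filtered_family (range (up_tail d)).
Proof.
split; first by exists (up_tail d 0), 0%N.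
move=> _ _ [m _ <-] [n _ <-]; exists (up_tail d (maxn m n)); first by exists (maxn m n).
by rewrite subsetI; split; apply: up_tailS; rewrite (leq_maxl, leq_maxr).
Qed.

Hypothesis wfY : well_filtered_space Y.

Lemma up_limit_sub_open d W : self_convergent d -> open W ->
  up_limit d `<=` W -> exists n, up_tail d n `<=` W.
Proof.
move=> sd oW dW; have [|||_ [n _ <-] nW] := wfY.2 W (range (up_tail d)) oW.
- by move=> _ [n _ <-]; exact: compact_saturated_up_tail.
- exact: filtered_up_tail.
- by move=> z dz; apply: dW => n _; apply: dz; exists n.
- by exists n.
Qed.

Lemma up_limit_meets d B : self_convergent d -> closed B ->
  (forall n, B (d n)) -> up_limit d `&` B !=set0.
Proof.
move=> sd cB dB.
have [||_ [n _ <-]|z [dz Bz]] :=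
    well_filtered_meets (F := range (up_tail d)) wfY _ _ cB.
- by move=> _ [n _ <-]; exact: compact_saturated_up_tail.
- exact: filtered_up_tail.
- by exists (d n); split; [exact: mem_up_tail|exact: dB].
- by exists z; split=> // n _; apply: dz; exists n.
Qed.

(** If [F] had no cluster point in [up_limit d], the open set of its non-cluster points would
    contain [up_limit d], hence by well-filteredness a whole tail; but that tail is compact and
    belongs to [F]. *)
Lemma compact_saturated_up_limit d : self_convergent d ->
  compact_saturated (up_limit d).
Proof.
move=> sd; split; last exact: saturated_up_limit.
  by have [|z []] := up_limit_meets sd closedT; last by exists z.
move=> F PF Fd; apply: contrapT => noclus.
have [|z dz Fz|n nF] := up_limit_sub_open (W := ~` cluster F) sd.
- apply: closed_openC; rewrite clusterE.
  by apply: closed_bigI => A _; exact: closed_closure.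
- by apply: noclus; exists z.
- have Fn : F (up_tail d n) by apply: filterS Fd => z; exact.
  by have [z [/nF]] := compact_up_tail sd PF Fn.
Qed.

(** An open set around [up_limit d] contains a tail of [d], so some [d n], so a tail of [e], which
    in turn contains [up_limit e]. *)
Lemma up_limit_sub d e : self_convergent d -> (forall n, e @ \oo --> d n) ->
  up_limit e `<=` up_limit d.
Proof.
move=> sd ed; apply: saturated_sub_open; first exact: saturated_up_limit.
move=> W oW /(up_limit_sub_open sd oW) [n nW].
have [m mW] : exists m, up_tail e m `<=` W.
  apply: (cvg_up_tail (ed n)); apply: open_nbhs_nbhs; split=> //.
  exact/nW/mem_up_tail.
by move=> z ez; apply: mW; exact: ez.
Qed.

End SelfConvergent.

(** * Irreducible sets and the diagonal choice *)

Section Irreducible.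
Variables (X : topologicalType) (A : set X).
Hypothesis irrA : irreducible_set A.

Lemma irreducible_meetsI (U V : set X) : open U -> open V ->
  A `&` U !=set0 -> A `&` V !=set0 -> A `&` (U `&` V) !=set0.
Proof.
move=> oU oV [u [Au Uu]] [v [Av Vv]]; apply: contrapT => AUV.
have [|AU|AV] := irrA.2 _ _ (open_closedC oU) (open_closedC oV).
- move=> z Az; rewrite -setCI => UVz; by apply: AUV; exists z.
- exact: AU Au Uu.
- exact: AV Av Vv.
Qed.

Lemma irreducible_meets_seq (s : seq X) (U : X -> set X) :
    (forall x, open (U x)) -> (forall x, U x x) ->
    (forall x, x \in s -> A x) ->
  exists2 z, A z & forall x, x \in s -> U x z.
Proof.
move=> oU Ux sA.
pose G t := \big[setI/setT]_(x <- t) U x.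
suff [z [Az Gz]] : A `&` G s !=set0.
  exists z => // x xs; move: Gz; rewrite /G -bigcap_seq; exact.
elim: s sA => [|x s IH] sA; rewrite /G ?big_nil ?big_cons.
  by rewrite setIT; exact: irrA.1.
apply: irreducible_meetsI => //.
- by apply: big_ind => //; [exact: openT|exact: openI].
- by exists x; split=> //; apply: sA; rewrite mem_head.
- by apply: IH => y ys; apply: sA; rewrite in_cons ys orbT.
Qed.

End Irreducible.

(** Smallness is required at all indices from some point on, so that the diagonal choice can use the
    same index [n] for every point listed at stage [n]. *)
Lemma first_countable_open_base (X : topologicalType) : first_countable X ->
  exists U : nat -> X -> set X, [/\ forall n x, open (U n x),
    forall n x, U n x x & forall x V, nbhs x V ->
      exists n, forall m, (n <= m)%N -> U m x `<=` V].
Proof.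
move=> fcX.
suff /choice [U UP] : forall x, exists U : nat -> set X,
    [/\ forall n, open (U n), forall n, U n x & forall V, nbhs x V ->
      exists n, forall m, (n <= m)%N -> U m `<=` V].
  exists (fun n x => U x n).
  by split=> [n x|n x|x V]; have [oU Ux UV] := UP x; [exact: oU|exact: Ux|exact: UV].
move=> x; have [B [cB Bx BV]] := fcX x.
have /countable_injP[g ginj] := cB.
(* [e] enumerates [B] along the injection [g]; an index that [g] does not reach from [B] gets the
   default [setT]. *)
have /choice[e eP] : forall n, exists W, nbhs x W /\
    forall W', B W' -> g W' = n -> W' = W.
  move=> n; have [[W [BW <-]]|nW] := pselect (exists W, B W /\ g W = n).
    exists W; split=> [|W' BW' gW']; first exact: Bx.
    by apply: ginj gW'; rewrite inE.
  exists setT; split=> [|W' BW' gW']; first exact: filterT.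
  by case: nW; exists W'.
(* Finite intersections decrease, so all indices from [g W] on stay inside [W]. *)
pose G n := \bigcap_(i in `I_n.+1) e i.
have xG n : nbhs x (G n).
  rewrite /G bigcap_mkord; apply: big_ind => [|P Q|i _].
  - exact: filterT.
  - exact: filterI.
  - exact: (eP i).1.
exists (fun n => interior (G n)); split=> [n|n|V /BV[W BW WV]].
- exact: open_interior.
- exact: xG.
- exists (g W) => m gm z /interior_subset Gz; apply: WV.
  by rewrite ((eP (g W)).2 W BW erefl); apply: Gz => /=; rewrite ltnS.
Qed.

(** Each [c n] is picked in [A] inside the [n]-th basic neighborhoods of [a 0], ..., [a n] and of
    all earlier terms of [c]. These are finitely many open sets meeting [A], so irreducibility
    provides such a point. *)
Lemma first_countable_irreducible_diagonal (X : topologicalType) (A : set X)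
    (a : nat -> X) : first_countable X -> irreducible_set A ->
    (forall n, A (a n)) ->
  exists c, [/\ forall n, A (c n), self_convergent c &
    forall n, c @ \oo --> a n].
Proof.
move=> /first_countable_open_base[U [oU Ux UV]] irrA Aa.
(* The choice ranges over all lists, so that [g] is available before the recursion; a list not
   contained in [A] gets the dummy value [a 0]. *)
have /choice[g gP] : forall p : nat * seq X, exists z,
    (forall x, x \in p.2 -> A x) ->
    A z /\ forall x, x \in p.2 -> U p.1 x z.
  move=> [n s] /=; have [sA|nsA] := pselect (forall x, x \in s -> A x).
    by have [z Az sz] := irreducible_meets_seq irrA (oU n) (Ux n) sA; exists z.
  by exists (a 0).
(* [s n] lists [a i] and [c i] for [i < n]; a point once listed stays listed, so [c] converges to
   it. *)
pose fix s n := if n is m.+1 then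
  g (m, a m :: s m) :: a m :: s m else [::].
pose c n := g (n, a n :: s n).
have sA n x : x \in s n -> A x.
  elim: n x => [//|n IH] x /=.
  have asA y : y \in a n :: s n -> A y.
    by rewrite in_cons => /predU1P[->//|]; exact: IH.
  by rewrite in_cons => /predU1P[->|/asA//]; have [] := gP (n, _) asA.
have cP n : A (c n) /\ forall x, x \in a n :: s n -> U n x (c n).
  apply: (gP (n, _)) => x /=.
  by rewrite in_cons => /predU1P[->//|]; exact: sA.
have smono m n x : (m <= n)%N -> x \in s m -> x \in s n.
  elim: n => [|n IH]; first by rewrite leqn0 => /eqP->.
  rewrite leq_eqVlt => /predU1P[->//|mn xs].
  by rewrite /= !in_cons IH ?orbT.
have cvg x m : x \in s m -> c @ \oo --> x.
  move=> xs V /UV[n nV]; exists (maxn m n) => // k /=.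
  rewrite geq_max => /andP[mk nk]; apply: (nV k nk).
  by apply: (cP k).2; rewrite in_cons (smono m) ?orbT.
exists c; split=> n; first exact: (cP n).1.
- by apply: (cvg _ n.+1); rewrite /= mem_head.
- by apply: (cvg _ n.+1); rewrite /= !in_cons eqxx orbT.
Qed.

Theorem theorem7p8 (X : topologicalType) :
  kolmogorov_space X -> first_countable X -> well_filtered_determined_space X.
Proof.
move=> T0X fcX; split=> // A _ irrA Y f wfY cf.
pose B := closure (f @` A).
have BfA x : A x -> B (f x) by move=> Ax; apply: subset_closure; exists x.
have cvgf c x : c @ \oo --> x -> (f \o c) @ \oo --> f x.
  by move=> cx; apply: cvg_comp cx _; exact: cf.
pose good := [set c : nat -> X | (forall n, A (c n)) /\ self_convergent c].
have goodf c : good c -> self_convergent (f \o c).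
  by move=> [_ sc] n; exact: cvgf.
pose F := [set up_limit (f \o c) | c in good].
have [||||b [Fb Bb]] := well_filtered_meets (F := F) (B := B) wfY.
- by move=> _ [c gc <-]; apply: compact_saturated_up_limit => //; exact: goodf.
- split.
    have [x Ax] := irrA.1.
    have [c [Ac sc _]] :=
      first_countable_irreducible_diagonal fcX irrA (fun _ : nat => Ax).
    by exists (up_limit (f \o c)), c.
  move=> _ _ [c gc <-] [c' gc' <-].
  (* Interleaving [c] and [c'] gives one sequence; a [d] converging to all its terms converges to
     every term of both, so its limit set lies below both limit sets. *)
  pose a n := if odd n then c n./2 else c' n./2.
  have Aa n : A (a n) by rewrite /a; case: ifP => _; [exact: gc.1|exact: gc'.1].
  have [d [Ad sd da]] := first_countable_irreducible_diagonal fcX irrA Aa.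
  exists (up_limit (f \o d)); first by exists d.
  rewrite subsetI; split; apply: up_limit_sub => //.
  + exact: goodf.
  + by move=> n; apply: cvgf; have := da n.*2.+1; rewrite /a /= odd_double uphalf_double.
  + exact: goodf.
  + by move=> n; apply: cvgf; have := da n.*2; rewrite /a odd_double doubleK.
- exact: closed_closure.
- move=> _ [c gc <-]; apply: up_limit_meets => //; first exact: goodf.
    exact: closed_closure.
  by move=> n; apply: BfA; exact: gc.1.
have fAb x : A x -> specialization_le (f x) b.
  (* The diagonal for the constant sequence [x]: every neighborhood of [f x] contains a saturated
     tail of [f \o c], and [b] lies in all of these tails. *)
  move=> Ax; have [c [Ac sc cx]] :=
    first_countable_irreducible_diagonal fcX irrA (fun _ : nat => Ax).
  move=> W /(cvg_up_tail (cvgf _ _ (cx 0%N)))[n nW].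
  exists b; split=> //; apply: nW; have Fc : F (up_limit (f \o c)) by exists c.
  exact: Fb Fc n I.
have Bcb : B = closure [set b].
  apply/seteqP; split.
  - rewrite /B closureE; apply: smallest_sub; first exact: closed_closure.
    by move=> _ [x Ax <-]; exact: fAb.
  - rewrite closureE; apply: smallest_sub; first exact: closed_closure.
    by move=> _ ->.
exists b; split=> // y By; apply: (closure1_inj wfY.1).
by rewrite /= -By -Bcb.
Qed.
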